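(* Let $(X,R)$ be a compact topological tournament. (a) If $R$ is nowhere locally transitive, then $X$ is totally disconnected and contains a dense set of cycle points for $R$. (b) If $R$ is balanced and the space $X$ is totally disconnected, then $R$ is nowhere locally transitive.
   Context: All spaces are Hausdorff. A tournament on a nonempty set $X$ is a relation $R\subset X\times X$ with $R\cap R^{-1}=1_X=\{(x,x):x\in X\}$ and $R\cup R^{-1}=X\times X$. Its set of arcs is $R^\circ=R\setminus 1_X$. $(X,R)$ is a compact topological tournament when $X$ is a compact space and $R$ is closed in $X\times X$. Write $R(x)=\{y:(x,y)\in R\}$, $R^\circ(x)=R(x)\setminus\{x\}$ (outset) and $R^{\circ-1}(x)=\{y:(y,x)\in R^\circ\}$ (inset). A point $x$ is balanced when it lies in the closure of its outset and in the closure of its inset; $R$ is balanced when every point of $X$ is balanced. A 3-cycle is a triple of distinct points with $(x_1,x_2),(x_2,x_3),(x_3,x_1)\in R^\circ$. A point $x$ is a cycle point when every neighborhood of $x$ contains a 3-cycle which includes $x$. $R$ is nowhere locally transitive when there is no nonempty open $U\subset X$ such that the restriction $R\cap(U\times U)$ is transitive; equivalently, every nonempty open subset of $X$ contains a 3-cycle. *)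

(* Defs.v *)
From mathcomp Require Import all_boot.
From mathcomp Require Import boolp classical_sets topology.

Set Implicit Arguments.
Unset Strict Implicit.
Unset Printing Implicit Defensive.

Local Open Scope classical_set_scope.
Local Open Scope relation_scope.

Definition is_tournament (X : Type) (R : set (X * X)) : Prop :=
  [/\ [set: X] !=set0,
      R `&` R^-1 = [set xy | xy.1 = xy.2]
    & R `|` R^-1 = setT].

Definition arcs (X : Type) (R : set (X * X)) : set (X * X) :=
  R `\` [set xy | xy.1 = xy.2].

Definition compact_topological_tournament (X : topologicalType)
    (R : set (X * X)) : Prop :=
  [/\ is_tournament R, hausdorff_space X, compact [set: X] & closed R].

Definition outset (X : Type) (R : set (X * X)) (x : X) : set X :=
  [set y | arcs R (x, y)].

Definition inset (X : Type) (R : set (X * X)) (x : X) : set X :=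
  [set y | arcs R (y, x)].

Definition balanced_point (X : topologicalType) (R : set (X * X)) (x : X) :
    Prop :=
  closure (outset R x) x /\ closure (inset R x) x.

Definition balanced (X : topologicalType) (R : set (X * X)) : Prop :=
  forall x, balanced_point R x.

Definition three_cycle (X : Type) (R : set (X * X)) (x1 x2 x3 : X) : Prop :=
  [/\ x1 <> x2, x2 <> x3 & x3 <> x1] /\
  [/\ arcs R (x1, x2), arcs R (x2, x3) & arcs R (x3, x1)].

Definition cycle_point (X : topologicalType) (R : set (X * X)) (x : X) : Prop :=
  forall U : set X, nbhs x U ->
    exists x1 x2 x3 : X,
      [/\ three_cycle R x1 x2 x3,
          [/\ U x1, U x2 & U x3]
        & [\/ x = x1, x = x2 | x = x3]].

Definition transitive_relation (X : Type) (S : set (X * X)) : Prop :=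
  forall x y z, S (x, y) -> S (y, z) -> S (x, z).

Definition nowhere_locally_transitive (X : topologicalType)
    (R : set (X * X)) : Prop :=
  ~ exists U : set X,
      [/\ U !=set0, open U & transitive_relation (R `&` (U `*` U))].

(* Main.v *)
Require Import Defs.
From mathcomp Require Import all_boot.
From mathcomp Require Import boolp classical_sets topology.

(** Two distinct points of a tournament are joined by exactly one arc, so for a
    closed tournament [R] the outset of a point [x] is the complement of the
    closed set [R^-1(x)], hence open, and likewise for the inset.

    Nowhere locally transitive implies totally disconnected.  A connected set
    that misses a point [z] lies wholly in [R(z)] or wholly in [R^-1(z)]
    ([connected_one_side]), and cutting a connected set [C] at one of its points
    leaves connected pieces ([connected_outsection]).  Together these make [R]
    transitive on [C] ([connected_transitive]).  If a component [C] contains an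
    arc [c -> d], consider the open set of all [y] with [c -> y -> d].  It lies
    in [C], because a point outside [C] cannot both follow [c] and precede [d];
    it is nonempty, because [C] is connected.  So [R] is transitive on a
    nonempty open set, a contradiction.

    Cycle points are dense ([cycle_point_in_open]).  Starting from a nonempty
    open [U_0], choose a 3-cycle [a_n -> b_n -> c_n -> a_n] in [U_n], and let
    [U_(n+1)] be a neighborhood of [a_n] with closure in [U_n] and with
    [c_n -> v -> b_n] for all its points [v].  By compactness [(b_n, c_n)] has a
    cluster point [(b, c)], and both [b] and [c] lie in every [U_n].  As [R] is
    closed, [b_n -> c_n] gives that [(b, c)] is in [R], while [c_n -> b] gives
    that [(c, b)] is in [R]; hence [b = c].  This point forms a 3-cycle with
    [b_n] and [c_n] for every [n], and [b_n, c_n] are simultaneously close to it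
    for arbitrarily large [n].  A sequence suffices although [X] need not be
    first countable: the point is only asked to be a cluster point.

    Balanced and totally disconnected implies nowhere locally transitive.  A
    nonempty open set on which [R] is transitive contains a nonempty clopen set
    [C], since quasicomponents of compact Hausdorff spaces are connected
    ([connected_quasicomponent]).  On the compact set [C] the relation [R] is a
    closed linear order, so [C] has a least point ([transitive_compact_min]).
    The neighborhood [C] of that point does not meet its inset, so the point is
    not balanced. *)

Set Implicit Arguments.
Unset Strict Implicit.
Unset Printing Implicit Defensive.

Local Open Scope classical_set_scope.

(** * Connected sets and closed covers *)

(** Disconnections by two closed sets are the form in which closedness of a
    tournament supplies them: the sections [R(z)] and [R^-1(z)] are closed and
    cover the space. *)
Lemma connected_closedP (T : topologicalType) (A : set T) :
  connected A <->
  forall F G : set T, closed F -> closed G -> A `<=` F `|` G ->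
    (forall y, A y -> F y -> ~ G y) -> A `<=` F \/ A `<=` G.
Proof.
split=> [cA F G cF cG AFG dis|H B [b Bb] [O oO BO] [D cD BD]].
  have [[y [Ay Fy]]|AF0] := pselect (A `&` F !=set0); last first.
    right=> y Ay; have [Fy|//] := AFG y Ay.
    by case: AF0; exists y.
  left; suff <- : A `&` F = A by move=> z [].
  apply: cA; [by exists y| |by exists F].
  exists (~` G); first exact: closed_openC.
  apply/seteqP; split=> z [Az Fz]; split=> //; first exact: dis Az Fz.
  by have [|] := AFG z Az.
have := H D (~` O) cD (open_closedC oO).
case.
- move=> y Ay; have [Oy|nOy] := pselect (O y); last by right.
  by left; have [] : (A `&` D) y by rewrite -BD BO.
- move=> y Ay Dy; apply; have [] // : (A `&` O) y.
  by rewrite -BO BD.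
- by move=> AD; rewrite BD; apply/seteqP; split=> [z []|z Az] //; split=> //; exact: AD.
- by move=> AO; move: Bb; rewrite BO => -[/AO].
Qed.

(** Suppose that [F] and [G] disconnect [C `&` F0], with [x] in [F].  The part
    of [C] in [G0] meets [C `&` F0] only at [x], so it can be added to [F], and
    this gives a disconnection of all of [C]. *)
Lemma connected_cut (T : topologicalType) (C F0 G0 : set T) (x : T) :
  connected C -> closed F0 -> closed G0 -> C `<=` F0 `|` G0 ->
  C x -> F0 x -> (forall y, C y -> F0 y -> G0 y -> y = x) ->
  connected (C `&` F0).
Proof.
move=> /connected_closedP cC cF0 cG0 CFG Cx F0x Ux; apply/connected_closedP.
move=> F G cF cG cov dis.
wlog Fx : F G cF cG cov dis / F x.
  move=> W; have [Fx|Gx] := cov x (conj Cx F0x); first exact: W.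
  by rewrite orC; apply: W => //; [rewrite setUC|move=> y Ay Gy /(dis y Ay)].
left=> y [Cy F0y].
have [||y1 Cy1|y1 Cy1|H|H] := cC ((F `&` F0) `|` G0) (G `&` F0).
- by apply: closedU => //; exact: closedI.
- exact: closedI.
- have [F0y1|] := CFG y1 Cy1; last by left; right.
  by have [Fy1|Gy1] := cov y1 (conj Cy1 F0y1); [left; left|right].
- move=> H [Gy1 F0y1]; have [[Fy1 _]|G0y1] := H.
    exact: dis Fy1 Gy1.
  have E := Ux _ Cy1 F0y1 G0y1.
  by apply: (dis x) => //; rewrite -E.
- have [[]//|G0y] := H y Cy.
  by rewrite (Ux _ Cy F0y G0y).
- have [Gx _] := H x Cx.
  by case: (dis x _ Fx Gx).
Qed.

(** * Clopen neighborhoods *)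

(** The traces on [~` P] of the clopen neighborhoods of [x] are closed and
    directed; if none were empty, compactness would give a point outside [P]
    that belongs to every clopen neighborhood of [x]. *)
Lemma clopen_sub_open (T : topologicalType) (x : T) (P : set T) :
  compact [set: T] -> open P ->
  (forall y, (forall C, clopen C -> C x -> C y) -> P y) ->
  exists C, [/\ clopen C, C x & C `<=` P].
Proof.
move=> cT oP QP; apply: contrapT => noC.
pose B := [set C : set T | clopen C /\ C x].
have FF : ProperFilter (filter_from B (fun C => C `&` ~` P)).
  apply: filter_from_proper; last first.
    move=> C [cC Cx]; apply: contrapT => CP0; apply: noC; exists C; split=> //.
    by move=> y Cy; apply: contrapT => nPy; apply: CP0; exists y.
  apply: filter_from_filter; first by exists setT; split=> //; exact: clopenT.
  move=> C1 C2 [cC1 C1x] [cC2 C2x]; exists (C1 `&` C2).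
    by split=> //; exact: clopenI.
  by move=> y [[]].
have [|q [_ Fq]] := cT _ FF; first exact: filterT.
have clq D : closed D -> filter_from B (fun C => C `&` ~` P) D -> D q.
  by move=> cD FD; apply: cD => W Wq; exact: Fq FD Wq.
have nPq : ~ P q.
  apply: (clq (~` P)); first exact: open_closedC.
  by exists setT; [split=> //; exact: clopenT|move=> y []].
apply/nPq/QP => C cC Cx; apply: clq; first by case: cC.
by exists C; [split|move=> y []].
Qed.

(** Let closed sets [F] and [G] disconnect the quasicomponent [Q] of [x], with
    [x] in [F].  By normality the two parts have disjoint open neighborhoods [P]
    and [P'].  Some clopen neighborhood [C] of [x] lies in their union, and then
    [C `&` P] is clopen: its complement in [C] is [C `&` P'].  It contains [x],
    hence all of [Q], so [Q `&` G] is empty. *)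
Lemma connected_quasicomponent (T : topologicalType) (x : T) :
  hausdorff_space T -> compact [set: T] ->
  connected [set y | forall C, clopen C -> C x -> C y].
Proof.
move=> hT cT; set Q := [set y | _]; apply/connected_closedP.
have Qx : Q x by move=> C.
move=> F G cF cG QFG dis.
have clQ : closed Q.
  by move=> y clQy C [oC cC] Cx; apply: (cC) => W /clQy [z [Qz Wz]];
    exists z; split=> //; exact: (Qz C (conj oC cC) Cx).
wlog Fx : F G cF cG QFG dis / F x.
  move=> W; have [Fx|Gx] := QFG x Qx; first exact: W.
  by rewrite orC; apply: W => //; [rewrite setUC|move=> y Ay Gy /(dis y Ay)].
left.
(* Here the second open set [P'] is the complement of [closure V]. *)
have [||V FV VG] := @compact_normal _ hT cT (Q `&` F) _ (~` (Q `&` G)).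
- exact: closedI.
- apply/set_nbhsP; exists (~` (Q `&` G)); split=> //.
    by apply: closed_openC; exact: closedI.
  by move=> y [Qy Fy] [_]; exact: dis.
have /set_nbhsP[P [oP FP PV]] := FV.
have [||C [[oC cC] Cx CP]] := @clopen_sub_open _ x (P `|` ~` closure V) cT.
- by apply: openU => //; apply: closed_openC; exact: closed_closure.
- move=> y Qy; have [Fy|Gy] := QFG y Qy; first by left; apply: FP.
  by right => /VG; apply.
have CPE : C `&` P = C `&` closure V.
  apply/seteqP; split=> y [Cy Py]; split=> //.
    exact/subset_closure/PV.
  by have [] := CP y Cy.
have cCP : clopen (C `&` P).
  by split; [exact: openI|rewrite CPE; apply: closedI => //; exact: closed_closure].
move=> y Qy; have [//|Gy] := QFG y Qy.
have [_ Py] := Qy _ cCP (conj Cx (FP _ (conj Qx Fx))).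
by have := VG _ (subset_closure (PV _ Py)); case.
Qed.

Lemma totally_disconnected_clopen_nbhs (T : topologicalType) (x : T)
    (U : set T) :
  hausdorff_space T -> compact [set: T] -> totally_disconnected [set: T] ->
  open U -> U x -> exists C, [/\ clopen C, C x & C `<=` U].
Proof.
move=> hT cT tdT oU Ux; apply: clopen_sub_open => // y Qy.
suff -> : y = x by [].
have : connected_component setT x y.
  by exists [set y | forall C, clopen C -> C x -> C y] => //; split=> //;
    exact: connected_quasicomponent.
by rewrite tdT.
Qed.

(** * Sections of a closed tournament *)

Lemma tournament_refl (X : Type) (R : set (X * X)) x :
  is_tournament R -> R (x, x).
Proof.
move=> [_ E _].
have : ([set xy | xy.1 = xy.2] : set (X * X)) (x, x) by [].
by rewrite -E => -[].
Qed.

Lemma tournament_antisym (X : Type) (R : set (X * X)) x y :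
  is_tournament R -> R (x, y) -> R (y, x) -> x = y.
Proof.
move=> [_ E _] xy yx.
have : (R `&` R^-1)%relation (x, y) by [].
by rewrite E.
Qed.

Lemma tournament_total (X : Type) (R : set (X * X)) x y :
  is_tournament R -> R (x, y) \/ R (y, x).
Proof.
move=> [_ _ E].
by have : (R `|` R^-1)%relation (x, y) by rewrite E.
Qed.

Lemma arcsE (X : Type) (R : set (X * X)) x y :
  is_tournament R -> arcs R (x, y) <-> ~ R (y, x).
Proof.
move=> tR; split=> [[Rxy /= xy] Ryx|nRyx]; first exact/xy/(tournament_antisym tR).
split=> [|/= E]; last by apply: nRyx; rewrite E; exact: tournament_refl.
by have [] := tournament_total x y tR.
Qed.

Lemma closed_outsection (X : topologicalType) (R : set (X * X)) x :
  closed R -> closed [set y | R (x, y)].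
Proof.
move=> cR; apply: (@preimage_closed _ _ (fun y => (x, y)) R) => // y.
by move=> _; apply: cvg_pair => /=; [exact: cvg_cst|exact: cvg_id].
Qed.

Lemma closed_insection (X : topologicalType) (R : set (X * X)) x :
  closed R -> closed [set y | R (y, x)].
Proof.
move=> cR; apply: (@preimage_closed _ _ (fun y => (y, x)) R) => // y.
by move=> _; apply: cvg_pair => /=; [exact: cvg_id|exact: cvg_cst].
Qed.

Lemma open_outset (X : topologicalType) (R : set (X * X)) x :
  is_tournament R -> closed R -> open (outset R x).
Proof.
move=> tR cR; rewrite (_ : outset R x = ~` [set y | R (y, x)]).
  by apply: closed_openC; exact: closed_insection.
by apply/seteqP; split=> y /(arcsE x y tR).
Qed.

Lemma open_inset (X : topologicalType) (R : set (X * X)) x :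
  is_tournament R -> closed R -> open (inset R x).
Proof.
move=> tR cR; rewrite (_ : inset R x = ~` [set y | R (x, y)]).
  by apply: closed_openC; exact: closed_outsection.
by apply/seteqP; split=> y /(arcsE y x tR).
Qed.

(** In a tournament a failure of transitivity [x -> y -> z] reverses the third
    arc, which closes up a 3-cycle. *)
Lemma nontransitive_three_cycle (X : topologicalType) (R : set (X * X))
    (U : set X) :
  is_tournament R -> nowhere_locally_transitive R -> open U -> U !=set0 ->
  exists a b c, [/\ U a, U b & U c] /\
    [/\ arcs R (a, b), arcs R (b, c) & arcs R (c, a)].
Proof.
move=> tR nR oU U0; apply: contrapT => no3; apply: nR; exists U; split=> //.
move=> x y z [Rxy [/= Ux Uy]] [Ryz [/= _ Uz]]; split=> //.
apply: contrapT => nxz; apply: no3; exists x, y, z; split=> //.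
have Azx := (arcsE z x tR).2 nxz.
split=> //; split=> //= E; apply: nxz; first by rewrite E.
by rewrite -E.
Qed.

(** * Connected sets in a tournament *)

Lemma connected_one_side (X : topologicalType) (R : set (X * X)) (A : set X) z :
  is_tournament R -> closed R -> connected A -> ~ A z ->
  A `<=` [set y | R (z, y)] \/ A `<=` [set y | R (y, z)].
Proof.
move=> tR cR /connected_closedP cA nAz; apply: cA.
- exact: closed_outsection.
- exact: closed_insection.
- by move=> y _; exact: tournament_total.
- by move=> y Ay /= zy yz; apply: nAz; rewrite (tournament_antisym tR zy yz).
Qed.

Lemma connected_outsection (X : topologicalType) (R : set (X * X)) (C : set X) x :
  is_tournament R -> closed R -> connected C -> C x ->
  connected (C `&` [set y | R (x, y)]).
Proof.
move=> tR cR cC Cx; apply: (@connected_cut _ _ _ [set y | R (y, x)] x) => //.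
- exact: closed_outsection.
- exact: closed_insection.
- by move=> y _; exact: tournament_total.
- exact: tournament_refl.
- by move=> y _ /= xy yx; exact: (tournament_antisym tR).
Qed.

(** If [x -> y -> z -> x], the connected set of successors of [x] in [C] misses
    [z] but contains both [x], which follows [z], and [y], which precedes it. *)
Lemma connected_transitive (X : topologicalType) (R : set (X * X)) (C : set X) :
  is_tournament R -> closed R -> connected C ->
  transitive_relation (R `&` (C `*` C)).
Proof.
move=> tR cR cC x y z [Rxy [/= Cx Cy]] [Ryz [/= _ Cz]]; split=> //.
apply: contrapT => nxz.
have [||H|H] := @connected_one_side _ _ (C `&` [set y | R (x, y)]) z tR cR.
- exact: connected_outsection.
- by case.
- apply: nxz; have /= Rzy := H y (conj Cy Rxy).
  by rewrite (tournament_antisym tR Rzy Ryz).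
- by apply/nxz/(H x); split=> //=; exact: tournament_refl.
Qed.

Lemma nowhere_locally_transitive_totally_disconnected
    (X : topologicalType) (R : set (X * X)) :
  is_tournament R -> closed R -> nowhere_locally_transitive R ->
  totally_disconnected [set: X].
Proof.
move=> tR cR nR x _.
have cC := @component_connected _ [set: X] x.
have Cx : connected_component [set: X] x x by exact: connected_component_refl.
set C := connected_component _ _ in cC Cx *.
suff C1 c d : C c -> C d -> R (c, d) -> c = d.
  apply/seteqP; split=> [y Cy|_ ->//].
  by have [/C1|/C1] := tournament_total x y tR; [move=> ->|apply].
move=> Cc Cd Rcd; apply: contrapT => cd; apply: nR.
exists (outset R c `&` inset R d).
(* A point outside [C] has all of [C] on one side, so it is not between [c]
   and [d]. *)
have UC : outset R c `&` inset R d `<=` C.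
  move=> y [Acy Ayd]; apply: contrapT => nCy.
  have [H|H] := connected_one_side tR cR cC nCy.
    by move/(arcsE c y tR): Acy; apply; exact: H.
  by move/(arcsE y d tR): Ayd; apply; exact: H.
split.
(* Were no point between [c] and [d], the successors of [c] in [C] would split
   into [c] itself and the successors of [d]. *)
- apply: contrapT => U0.
  have /connected_closedP := connected_outsection tR cR cC Cc.
  move=> /(_ [set y | R (y, c)] [set y | R (d, y)]).
  case.
  + exact: closed_insection.
  + exact: closed_outsection.
  + move=> y [Cy /= Rcy]; apply: contrapT => /not_orP[/= nyc ndy].
    by apply: U0; exists y; split; apply/arcsE.
  + move=> y [Cy /= Rcy] Ryc Rdy; apply: cd.
    have E := tournament_antisym tR Rcy Ryc; move: Rdy; rewrite /= -E.
    exact: tournament_antisym.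
  + by move=> /(_ d (conj Cd Rcd)) /(tournament_antisym tR Rcd).
  + move=> /(_ c); move=> /(_ (conj Cc (tournament_refl c tR))).
    by move=> /(tournament_antisym tR Rcd).
- by apply: openI; [exact: open_outset|exact: open_inset].
- move=> u v w [Ruv [/= Uu Uv]] [Rvw [/= _ Uw]]; split=> //.
  have := @connected_transitive _ _ C tR cR cC u v w.
  by case=> //; split=> //; split; exact: UC.
Qed.

(** * Cycle points *)

Lemma compact_sequence_cluster (T : topologicalType) (u : nat -> T) :
  compact [set: T] ->
  exists p : T, forall (W : set T) N, nbhs p W -> exists2 n, N <= n & W (u n).
Proof.
move=> cT.
have [|p [_ Fp]] := cT (u @ \oo) _; first exact: filterT.
exists p => W N Wp.
have [|_ [[n /= Nn <-] Wn]] := Fp (u @` [set n | N <= n]) W _ Wp.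
  by exists N => // n /= Nn; exists n.
by exists n.
Qed.

(** One step of the nested construction.  The triple [p] is [(V, b, c)], where
    [a -> b -> c -> a] is a 3-cycle in [U] and [V] is so small a neighborhood of
    [a] that each of its points may replace [a] in the cycle. *)
Lemma shrink_three_cycle (X : topologicalType) (R : set (X * X)) (U : set X) :
  compact_topological_tournament R -> nowhere_locally_transitive R ->
  open U -> U !=set0 ->
  exists p : set X * X * X,
    [/\ open p.1.1, p.1.1 !=set0 & closure p.1.1 `<=` U] /\
    [/\ U p.1.2, U p.2, arcs R (p.1.2, p.2)
      & p.1.1 `<=` outset R p.2 `&` inset R p.1.2].
Proof.
move=> [tR hX cX cR] nR oU U0.
have [a [b [c [[Ua Ub Uc] [ab bc ca]]]]] := nontransitive_three_cycle tR nR oU U0.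
have oW : open (U `&` (outset R c `&` inset R b)).
  by apply: openI => //; apply: openI; [exact: open_outset|exact: open_inset].
have [|V Va VW] := @compact_regular _ a setT hX cX filterT
  (U `&` (outset R c `&` inset R b)).
  exact: open_nbhs_nbhs.
exists (V°, b, c); split; split=> //=.
- exact: open_interior.
- by exists a.
- apply: subset_trans (closureS (@interior_subset _ V)) _.
  by move=> y /VW [].
- by move=> y /interior_subset /subset_closure /VW [].
Qed.

(** The sets [U n] need not shrink to a point; for a cluster point
    [(x, y)] of the pairs [(b n, c n)], the equality [x = y] comes from
    antisymmetry.  Membership of [x] in
    all the [U n] is what keeps the arcs [c n -> x] available in the limit. *)
Lemma cycle_point_in_open (X : topologicalType) (R : set (X * X)) (U0 : set X) :
  compact_topological_tournament R -> nowhere_locally_transitive R ->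
  open U0 -> U0 !=set0 -> exists2 x, U0 x & cycle_point R x.
Proof.
move=> hR nR oU0 neU0; have [tR hX cX cR] := hR.
have [x0 _] := neU0.
have /choice[f fP] : forall U : set X, exists p : set X * X * X,
    open U /\ U !=set0 ->
    [/\ open p.1.1, p.1.1 !=set0 & closure p.1.1 `<=` U] /\
    [/\ U p.1.2, U p.2, arcs R (p.1.2, p.2)
      & p.1.1 `<=` outset R p.2 `&` inset R p.1.2].
  move=> U; have [[oU neU]|nU] := pselect (open U /\ U !=set0).
    by have [p Hp] := shrink_three_cycle hR nR oU neU; exists p.
  (* A dummy value, used only outside the nonempty open sets. *)
  by exists (U, x0, x0).
pose U n := iter n (fun V => (f V).1.1) U0.
have goodU n : open (U n) /\ U n !=set0.
  by elim: n => [|n /fP[[]]].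
pose b n := (f (U n)).1.2; pose c n := (f (U n)).2.
have clU n : closure (U n.+1) `<=` U n by have [[]] := fP _ (goodU n).
have decU m n : m <= n -> U n `<=` U m.
  move=> /subnK <-; elim: (n - m) => // k IH.
  apply: subset_trans IH; apply: subset_trans (clU _); exact: subset_closure.
have Ub n : U n (b n) by have [_ []] := fP _ (goodU n).
have Uc n : U n (c n) by have [_ []] := fP _ (goodU n).
have bc n : arcs R (b n, c n) by have [_ []] := fP _ (goodU n).
have UU n v : U n.+1 v -> arcs R (c n, v) /\ arcs R (v, b n).
  by have [_ [_ _ _ H]] := fP _ (goodU n) => /H.
have [|[x y] clxy] := @compact_sequence_cluster _ (fun n => (b n, c n)).
  by rewrite -setXTT; exact: compact_setX.
have lim (Z : set (X * X)) N : closed Z ->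
    (forall n, N <= n -> Z (b n, c n)) -> Z (x, y).
  move=> cZ ZN; apply: cZ => W /(clxy W N)[n Nn Wn].
  by exists (b n, c n); split=> //; exact: ZN.
have Ux n : U n x.
  apply: (clU n); apply: (lim (fst @^-1` closure (U n.+1)) n.+1).
    by apply: preimage_closed; [move=> ? _; exact: cvg_fst|exact: closed_closure].
  by move=> k /decU nk; apply/subset_closure/nk.
have Rxy : R (x, y) by apply: (lim R 0) => // n _; case: (bc n).
have Ryx : R (y, x).
  apply: (lim (snd @^-1` [set z | R (z, x)]) 0).
    by apply: preimage_closed; [move=> ? _; exact: cvg_snd|exact: closed_insection].
  by move=> n _; have [[]] := UU n x (Ux n.+1).
have E : x = y := tournament_antisym tR Rxy Ryx.
exists x; first exact: Ux 0.
move=> W Wx; have [|n _ [/= Wb Wc]] := clxy (W `*` W) 0.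
  by exists (W, W) => //=; split=> //; rewrite -E.
have [cx xb] := UU n x (Ux n.+1).
exists x, (b n), (c n); split; last by constructor.
- by split; split=> //; [case: xb|case: (bc n)|case: cx].
- by split=> //; exact: nbhs_singleton.
Qed.

(** * Balanced tournaments *)

(** By transitivity the initial segments [R^-1(x)] of [C] form a chain of
    nonempty closed sets; a point common to all of them is least. *)
Lemma transitive_compact_min (X : topologicalType) (R : set (X * X))
    (C : set X) :
  is_tournament R -> closed R -> compact C -> C !=set0 ->
  transitive_relation (R `&` (C `*` C)) ->
  exists2 m, C m & forall x, C x -> R (m, x).
Proof.
move=> tR cR cC [x0 Cx0] trC.
pose B x := C `&` [set y | R (y, x)].
have sub x y : C x -> C y -> R (x, y) -> B x `<=` B y.
  by move=> Cx Cy xy z [Cz zx]; split=> //; have [] := trC z x y.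
have FF : ProperFilter (filter_from C B).
  apply: filter_from_proper; last first.
    by move=> x Cx; exists x; split=> //; exact: tournament_refl.
  apply: filter_from_filter; first by exists x0.
  move=> x y Cx Cy; have [xy|yx] := tournament_total x y tR.
    by exists x => // z Bz; split=> //; exact: sub Bz.
  by exists y => // z Bz; split=> //; exact: sub Bz.
have [|m [Cm Fm]] := cC _ FF; first by exists x0 => // z [].
exists m => // x Cx; apply: (@closed_insection _ R x cR m) => W Wm.
apply: Fm Wm; exists x => //.
by move=> z [].
Qed.

Lemma balanced_nowhere_locally_transitive (X : topologicalType)
    (R : set (X * X)) :
  compact_topological_tournament R -> balanced R ->
  totally_disconnected [set: X] -> nowhere_locally_transitive R.
Proof.
move=> [tR hX cX cR] bR tdX [U [[x Ux] oU trU]].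
have [C [[oC cC] Cx CU]] := totally_disconnected_clopen_nbhs hX cX tdX oU Ux.
have [|||m Cm mC] := @transitive_compact_min _ _ C tR cR.
- by apply: (subclosed_compact cC cX).
- by exists x.
- move=> u v w [Ruv [/= Cu Cv]] [Rvw [/= _ Cw]]; split=> //.
  by case: (trU u v w) => //; split=> //; split; exact: CU.
have [_ clm] := bR m.
have [|y [ym Cy]] := clm C; first exact: open_nbhs_nbhs.
by move/(arcsE y m tR): ym; apply; exact: mC.
Qed.

Unset Implicit Arguments.
Set Strict Implicit.

Theorem theorem1p4 (X : topologicalType) (R : set (X * X))
    (hR : compact_topological_tournament R) :
  (nowhere_locally_transitive R ->
     totally_disconnected [set: X] /\
     exists2 D : set X, dense D & D `<=` [set x | cycle_point R x]) /\
  (balanced R -> totally_disconnected [set: X] ->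
     nowhere_locally_transitive R).
Proof.
split=> [nR|]; last exact: balanced_nowhere_locally_transitive.
split; first by case: hR => tR _ _ cR;
  exact: nowhere_locally_transitive_totally_disconnected nR.
exists [set x | cycle_point R x] => // U U0 oU.
by have [x Ux cx] := cycle_point_in_open hR nR oU U0; exists x.
Qed.
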